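(* Let $d\ge 1$ be an integer. Suppose that $r(t)=(r_1(t)>\dots>r_d(t)>0)$ satisfies $$\dot r_k(t)=\gamma_1\sum_{j\colon j\ne k}\left(\frac{1}{r_k(t)-r_j(t)}+\frac{1}{r_k(t)+r_j(t)}\right)+\frac{\gamma_2}{r_k(t)},\qquad k=1,\dots,d,\qquad (\mathrm{A})$$ for all $t\ge 0$ and some $\gamma_1,\gamma_2\ge 0$. Then $r(t)$ also satisfies the Calogero–Moser equations of type $BC$ with an attractive potential, $$\ddot r_k(t)=-2\gamma_1^2\sum_{j\colon j\ne k}\left(\frac{1}{(r_k(t)-r_j(t))^3}+\frac{1}{(r_k(t)+r_j(t))^3}\right)-\frac{\gamma_2^2}{r_k(t)^3},\qquad k=1,\dots,d,\qquad (\mathrm{B})$$ for all $t\ge 0$. Conversely, any solution $r(t)=(r_1(t)>\dots>r_d(t)>0)$, $t\ge 0$, to (B) that satisfies (A) at $t=0$ satisfies (A) for all $t\ge 0$.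
   Context: Dots denote derivatives with respect to $t$ (one-sided at $t=0$). Sums over $j$ range over $j\in\{1,\dots,d\}\setminus\{k\}$. *)

(* Defs.v *)
From HB Require Import structures.
From mathcomp Require Import all_boot all_order all_algebra.
From mathcomp Require Import all_classical all_reals all_analysis.
Set Implicit Arguments.
Unset Strict Implicit.
Unset Printing Implicit Defensive.
Import Order.TTheory GRing.Theory Num.Theory.
Import numFieldNormedType.Exports.
Local Open Scope classical_set_scope.
Local Open Scope ring_scope.

(* Functions of time are total functions on R of which only the values at
   t >= 0 matter: every predicate below is used for t >= 0 only, and there it
   does not depend on the values of f at negative times. *)

Definition has_right_derivative (R : realType) (f : R -> R) (t l : R) : Prop :=
  h^-1 * (f (t + h) - f t) @[h --> 0^'+] --> l.

(* f has derivative l at the time t >= 0, one-sided at t = 0 *)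
Definition has_dot (R : realType) (f : R -> R) (t l : R) : Prop :=
  if t == 0 then has_right_derivative f 0 l else is_derive t 1 f l.

(* f is differentiable on [0, +oo[ and its derivative v has derivative l at t *)
Definition has_ddot (R : realType) (f : R -> R) (t l : R) : Prop :=
  exists v : R -> R,
    (forall s : R, 0 <= s -> has_dot f s (v s)) /\ has_dot v t l.

(* x_1 > ... > x_d > 0 *)
Definition in_chamber (R : realType) (d : nat) (x : 'I_d -> R) : Prop :=
  (forall i j : 'I_d, (i < j)%N -> x j < x i) /\ (forall k : 'I_d, 0 < x k).

Definition first_order_rhs (R : realType) (d : nat) (gamma1 gamma2 : R)
    (x : 'I_d -> R) (k : 'I_d) : R :=
  gamma1 * (\sum_(j < d | j != k) ((x k - x j)^-1 + (x k + x j)^-1))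
  + gamma2 / x k.

Definition calogero_moser_rhs (R : realType) (d : nat) (gamma1 gamma2 : R)
    (x : 'I_d -> R) (k : 'I_d) : R :=
  - 2 * gamma1 ^+ 2 *
    (\sum_(j < d | j != k)
       (((x k - x j) ^+ 3)^-1 + ((x k + x j) ^+ 3)^-1))
  - gamma2 ^+ 2 / x k ^+ 3.

Definition satisfies_A_at (R : realType) (d : nat) (gamma1 gamma2 : R)
    (r : R -> 'I_d -> R) (t : R) : Prop :=
  forall k : 'I_d,
    has_dot (fun s => r s k) t (first_order_rhs gamma1 gamma2 (r t) k).

Definition satisfies_B_at (R : realType) (d : nat) (gamma1 gamma2 : R)
    (r : R -> 'I_d -> R) (t : R) : Prop :=
  forall k : 'I_d,
    has_ddot (fun s => r s k) t (calogero_moser_rhs gamma1 gamma2 (r t) k).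

(* Main.v *)
Require Import Defs.
From HB Require Import structures.
From mathcomp Require Import all_boot all_order all_algebra.
From mathcomp Require Import all_classical all_reals all_analysis.
From mathcomp Require Import ring lra.
Set Implicit Arguments.
Unset Strict Implicit.
Unset Printing Implicit Defensive.
Import Order.TTheory GRing.Theory Num.Theory.
Import numFieldNormedType.Exports.
Local Open Scope classical_set_scope.
Local Open Scope ring_scope.

(** Write (A) as r' = F(r). Along any differentiable curve r in the chamber the
    chain rule gives (F(r))' = DF(r) r'. The whole theorem rests on one identity
    between rational functions, [linearized_first_order]: DF(x) F(x) is the
    Calogero-Moser force B(x) on the right of (B). In it the terms in
    gamma1 * gamma2 cancel for each pair of particles, the terms that involve
    three distinct particles cancel because they are antisymmetric in the two
    particles other than k, and only the terms with an inverse cube are left.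

    If r solves (A), then r'' = (F(r))' = DF(r) F(r) = B(r), which is (B).

    Conversely, let r solve (B) and put w = r' - F(r). Then
    w' = B(r) - DF(r) r' = DF(r) (F(r) - r') = - DF(r) w, a homogeneous linear
    equation, and w vanishes at time 0 if (A) holds there. On [0, T] the trajectory
    stays away from the walls of the chamber, so the coefficients of this equation
    are bounded and the energy E, the sum of the w_k^2, satisfies E' <= M E; hence
    E = 0 on [0, T] by Gronwall ([linearized_flow_eq0]).

    The derivative at time 0 is one-sided. A function on [0, +oo[ has a dot at t
    exactly when it agrees there with a function on the line that is
    differentiable at t ([has_dotP]); the rules of calculus, the mean value theorem
    and the extreme value theorem carry over from the line in this way. *)

(** * Calculus of one-sided derivatives on the half-line *)

Section HasDot.
Context {R : realType}.
Implicit Types (f g : R -> R) (l m t : R).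

(** Continuing [f] to negative times along a line of slope [l] makes it
    differentiable at [0] when [l] is the right derivative of [f] there. *)
Definition tangent_extension f l : R -> R :=
  fun s => if 0 <= s then f s else f 0 + l * s.

Lemma tangent_extensionE f l s : 0 <= s -> tangent_extension f l s = f s.
Proof. by rewrite /tangent_extension => ->. Qed.

(** The hypothesis [t = 0 -> m = l] lets one extension, with [l] the right
    derivative at [0], serve all the times [t >= 0] at once. *)
Lemma is_derive_tangent_extension f l t m : 0 <= t -> has_dot f t m ->
  (t = 0 -> m = l) -> is_derive t 1 (tangent_extension f l) m.
Proof.
rewrite /has_dot le_eqVlt eq_sym; case: eqP => [->|_] /= t0 fm ml; last first.
  apply: near_eq_is_derive fm; near=> s.
  by rewrite tangent_extensionE //; near: s; exact: lt_le_nbhsr.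
rewrite -{l ml}(ml erefl).
have quotient_cvg : h^-1 *: ((tangent_extension f m \o shift 0) (h *: 1)
    - tangent_extension f m 0) @[h --> 0^'] --> m.
  apply: (@cvg_at_right_left_dnbhs _ R^o).
    apply: cvg_trans fm; apply: near_eq_cvg; near=> h.
    have h0 : 0 < h by near: h; exact: nbhs_right_gt.
    by rewrite /= !tangent_extensionE // ?scaler1 ?addr0 ?add0r ?ltW.
  have : m @[_ --> (0 : R)^'-] --> m by exact: cvg_cst.
  apply: cvg_trans; apply: near_eq_cvg; near=> h.
  have h0 : h < 0 by near: h; exact: nbhs_left_lt.
  rewrite /= scaler1 addr0 /tangent_extension lexx leNgt h0 /=.
  by rewrite addrAC subrr add0r /GRing.scale /= mulrCA mulVf ?mulr1 ?ltr0_neq0.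
by apply: DeriveDef; [exact: cvgP quotient_cvg | exact: cvg_lim quotient_cvg].
Unshelve. all: by end_near. Qed.

(** The one-sided case disappears here: each rule below is the rule for
    [is_derive] applied to the functions that this equivalence provides. *)
Lemma has_dotP f t l : 0 <= t ->
  has_dot f t l <->
  exists2 g, (forall s, 0 <= s -> g s = f s) & is_derive t 1 g l.
Proof.
move=> t0; split=> [fl|[g gf gl]].
  exists (tangent_extension f l); first exact: tangent_extensionE.
  exact: is_derive_tangent_extension.
rewrite /has_dot; case: eqP => [te|/eqP tn].
  rewrite te in gl; rewrite /has_right_derivative.
  have [gd gv] := gl.
  have := cvg_dnbhs_at_right gd; rewrite -/(derive g 0 1) gv.
  apply: cvg_trans; apply: near_eq_cvg; near=> h.
  have h0 : 0 < h by near: h; exact: nbhs_right_gt.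
  by rewrite /= scaler1 addr0 add0r !gf // ltW.
have tp : 0 < t by rewrite lt_neqAle eq_sym tn.
apply: near_eq_is_derive gl; near=> s.
by rewrite gf //; near: s; exact: lt_le_nbhsr.
Unshelve. all: by end_near. Qed.

Lemma has_dot_eq f g t l : 0 <= t -> (forall s, 0 <= s -> f s = g s) ->
  has_dot f t l -> has_dot g t l.
Proof.
move=> t0 fg /(has_dotP _ _ t0)[h hf hl]; apply/(has_dotP _ _ t0).
by exists h => // s s0; rewrite hf ?fg.
Qed.

Lemma has_dot_unique f t l m : has_dot f t l -> has_dot f t m -> l = m.
Proof.
rewrite /has_dot; case: eqP => _ fl fm.
  exact: cvg_unique fl fm.
by rewrite -(@derive_val _ _ _ _ _ _ _ fl) -(@derive_val _ _ _ _ _ _ _ fm).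
Qed.

Lemma is_derive_has_dot f t l : 0 <= t -> is_derive t 1 f l -> has_dot f t l.
Proof. by move=> t0 fl; apply/has_dotP => //; exists f. Qed.

Lemma has_dot_cst c t : 0 <= t -> has_dot (fun=> c) t 0.
Proof. by move=> t0; apply: is_derive_has_dot => //; exact: is_derive_cst. Qed.

Lemma has_dotD f g t l m : 0 <= t -> has_dot f t l -> has_dot g t m ->
  has_dot (fun s => f s + g s) t (l + m).
Proof.
move=> t0 /(has_dotP _ _ t0)[F Ff Fl] /(has_dotP _ _ t0)[G Gg Gm].
apply/has_dotP => //; exists (F + G); last exact: is_deriveD.
by move=> s s0 /=; rewrite -Ff // -Gg.
Qed.

Lemma has_dotM f g t l m : 0 <= t -> has_dot f t l -> has_dot g t m ->
  has_dot (fun s => f s * g s) t (f t * m + g t * l).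
Proof.
move=> t0 /(has_dotP _ _ t0)[F Ff Fl] /(has_dotP _ _ t0)[G Gg Gm].
apply/has_dotP => //; exists (F * G); last first.
  by rewrite -Ff // -Gg //; exact: is_deriveM.
by move=> s s0 /=; rewrite -Ff // -Gg.
Qed.

Lemma has_dotZ c f t l : 0 <= t -> has_dot f t l ->
  has_dot (fun s => c * f s) t (c * l).
Proof.
move=> t0 fl; have := has_dotM t0 (has_dot_cst c t0) fl.
by rewrite mulr0 addr0.
Qed.

Lemma has_dotB f g t l m : 0 <= t -> has_dot f t l -> has_dot g t m ->
  has_dot (fun s => f s - g s) t (l - m).
Proof.
move=> t0 fl /(has_dotZ (-1) t0) gm.
rewrite -[- m]mulN1r; apply: has_dot_eq (has_dotD t0 fl gm) => // s _.
by rewrite mulN1r.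
Qed.

Lemma has_dotV f t l : 0 <= t -> f t != 0 -> has_dot f t l ->
  has_dot (fun s => (f s)^-1) t (- l / f t ^+ 2).
Proof.
move=> t0 ft0 /(has_dotP _ _ t0)[F Ff Fl].
apply/has_dotP => //; exists (fun s => (F s)^-1).
  by move=> s s0; rewrite Ff.
have -> : - l / f t ^+ 2 = - (F t) ^- 2 *: l.
  by rewrite Ff // /GRing.scale /= mulNr mulrC mulNr.
by apply: is_deriveV => //; rewrite Ff.
Qed.

Lemma has_dot_sum (I : Type) (s : seq I) (P : pred I) (f : I -> R -> R)
    (l : I -> R) t : 0 <= t -> (forall i, P i -> has_dot (f i) t (l i)) ->
  has_dot (fun x => \sum_(i <- s | P i) f i x) t (\sum_(i <- s | P i) l i).
Proof.
move=> t0 fl; elim: s => [|i s IHs].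
  rewrite big_nil; apply: has_dot_eq (has_dot_cst 0 t0) => // x _.
  by rewrite big_nil.
rewrite big_cons; case: ifPn => Pi; last first.
  by apply: has_dot_eq IHs => // x _; rewrite big_cons (negbTE Pi).
apply: has_dot_eq (has_dotD t0 (fl _ Pi) IHs) => // x _.
by rewrite big_cons Pi.
Qed.

(** Global form of [has_dotP], with a single function on the line for all
    times: theorems about functions on an interval [[0, T]] need this. *)
Lemma has_dot_extension f (df : R -> R) :
  (forall s : R, 0 <= s -> has_dot f s (df s)) ->
  exists2 g, (forall s : R, 0 <= s -> g s = f s) &
             (forall s : R, 0 <= s -> is_derive s 1 g (df s)).
Proof.
move=> fdf; exists (tangent_extension f (df 0)).
  exact: tangent_extensionE.
by move=> s s0; apply: is_derive_tangent_extension (fdf _ s0) _ => // ->.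
Qed.

Lemma is_derive_within_continuous g (dg : R -> R) (T : R) :
  (forall s : R, 0 <= s -> is_derive s 1 g (dg s)) ->
  {within `[0, T], continuous g}.
Proof.
move=> gdg; apply: derivable_within_continuous => s.
by rewrite in_itv /= => /andP[s0 _]; have [] := gdg _ s0.
Qed.

Lemma has_dot_bounded f (T : R) : 0 <= T ->
  (forall s, 0 <= s -> exists l, has_dot f s l) ->
  exists M, forall s, 0 <= s <= T -> f s <= M.
Proof.
move=> T0 fd.
have /choice[df fdf] : forall s, exists l, 0 <= s -> has_dot f s l.
  move=> s; have [s0|_] := boolP (0 <= s); last by exists 0.
  by have [l fl] := fd _ s0; exists l.
have [g gf gd] := has_dot_extension fdf.
have [c] := EVT_max T0 (is_derive_within_continuous (T := T) gd).
move=> _ gc; exists (g c) => s /andP[s0 sT].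
by rewrite -gf //; apply: gc; rewrite in_itv /= s0.
Qed.

Lemma has_dot_le0_nonincreasing f (df : R -> R) (T : R) : 0 <= T ->
  (forall s, 0 <= s -> has_dot f s (df s)) ->
  (forall s, 0 <= s <= T -> df s <= 0) -> f T <= f 0.
Proof.
move=> T0 fdf df0; have [g gf gd] := has_dot_extension fdf.
rewrite -!gf // -subr_le0.
have gd_oo s : s \in `]0, T[ -> is_derive s 1 g (df s).
  by rewrite in_itv /= => /andP[/ltW s0 _]; exact: gd.
have [c] := MVT_segment T0 gd_oo (is_derive_within_continuous (T := T) gd).
by rewrite in_itv /= => cT ->; rewrite subr0 mulr_le0_ge0 // df0.
Qed.

(** The product of [f] with the integrating factor [expR (- C * s)] has
    derivative [expR (- C * s) * (df s - C * f s)], which is nonpositive. *)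
Lemma gronwall_le0 f (df : R -> R) (C T : R) : 0 <= T ->
  (forall s, 0 <= s -> has_dot f s (df s)) ->
  (forall s, 0 <= s <= T -> df s <= C * f s) -> f 0 <= 0 -> f T <= 0.
Proof.
move=> T0 fdf dfC f0.
have expd s : 0 <= s ->
    has_dot (fun s => expR (- C * s)) s (- C * expR (- C * s)).
  move=> s0; apply: is_derive_has_dot => //.
  have lin : is_derive s 1 ( *%R (- C)) (- C).
    have := @is_deriveZ _ _ _ id (- C) s 1 1 (is_derive_id _ _).
    by rewrite /GRing.scale /= mulr1.
  by rewrite mulrC; exact: is_derive1_comp (is_derive_expR _) lin.
pose g s := f s * expR (- C * s).
have gd s (s0 : 0 <= s) := has_dotM s0 (fdf _ s0) (expd _ s0).
have : g T <= g 0.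
  apply: has_dot_le0_nonincreasing gd _ => // s sT.
  have -> : f s * (- C * expR (- C * s)) + expR (- C * s) * df s =
            expR (- C * s) * (df s - C * f s) by ring.
  by rewrite mulr_ge0_le0 ?expR_ge0 // subr_le0 dfC.
rewrite /g mulr0 expR0 mulr1 => /le_trans/(_ f0).
by rewrite pmulr_lle0 ?expR_gt0.
Qed.

End HasDot.
(** * The vector field of the first-order system and its linearization *)

Section VectorField.
Context {R : realType} {d : nat}.
Implicit Types x u w : 'I_d -> R.

Lemma in_chamber_neq0 x : in_chamber x ->
  [/\ (forall k, x k != 0), (forall i j, j != i -> x i - x j != 0)
    & (forall i j, x i + x j != 0)].
Proof.
move=> [xlt x0]; split=> [k|i j ji|i j]; first by rewrite gt_eqF.
  rewrite subr_eq0.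
  by case: (ltngtP i j) ji => [/xlt/gt_eqF->|/xlt/lt_eqF->|/val_inj->];
    rewrite ?eqxx.
by rewrite gt_eqF ?addr_gt0.
Qed.

(** The directional derivative at [x], along [u], of the [k]-th component of
    [first_order_rhs]; see [has_dot_first_order_rhs]. *)
Definition linearized_rhs (gamma1 gamma2 : R) x u k : R :=
  - (gamma1 * (\sum_(j < d | j != k)
       ((u k - u j) / (x k - x j) ^+ 2 + (u k + u j) / (x k + x j) ^+ 2))
     + gamma2 * (u k / x k ^+ 2)).

Lemma linearized_rhsB gamma1 gamma2 x u w k :
  linearized_rhs gamma1 gamma2 x (fun j => u j - w j) k =
  linearized_rhs gamma1 gamma2 x u k - linearized_rhs gamma1 gamma2 x w k.
Proof.
rewrite /linearized_rhs.
set A := \sum_(j < d | _) _; set B := \sum_(j < d | _) _.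
set C := \sum_(j < d | _) _.
have -> : A = B - C.
  by rewrite /A /B /C -sumrB; apply: eq_bigr => j _; ring.
ring.
Qed.

Lemma antisymmetric_sum0 (k : 'I_d) (T : 'I_d -> 'I_d -> R) :
  (forall i j, i != k -> j != k -> i != j -> T j i = - T i j) ->
  \sum_(i < d | i != k) \sum_(j < d | (j != k) && (j != i)) T i j = 0.
Proof.
move=> antiT; set S := LHS.
suff SN : S = - S by lra.
rewrite {1}/S (exchange_big_dep (fun i => i != k)) /=; last first.
  by move=> i j _ /andP[].
rewrite -sumrN; apply: eq_bigr => j jk; rewrite -sumrN.
apply: eq_big => [i|i /and3P[ik _ ji]]; first by rewrite jk (eq_sym j).
by rewrite -antiT // eq_sym.
Qed.

(** Let [S i] be the sum that multiplies [gamma1] in the [i]-th component of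
    F. Expanding DF F gives
    - in [gamma2 ^+ 2], the single term that appears in the force;
    - in [gamma1 * gamma2], the sum [crossE], which cancels the contribution of
      [S k / x k ^+ 2];
    - in [gamma1 ^+ 2], a sum over the particles [j] of the terms of [pairE].
      There the [j]-th term of [S k] and the [k]-th term of [S j] produce the
      inverse cubes, and the other terms make up the three-body function [T].
      Since 1/(x k - x l) - 1/(x j - x l) is - (x k - x j) times
      1/((x k - x l) (x j - x l)), the double poles of [T] become simple ones,
      as in - 1/((x k - x j) (x k - x l) (x j - x l)), and likewise for the other
      choices of signs; the products that result are antisymmetric in [j] and
      [l], either one by one or in pairs. *)
Lemma linearized_first_order gamma1 gamma2 x k : in_chamber x ->
  linearized_rhs gamma1 gamma2 x (first_order_rhs gamma1 gamma2 x) k =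
  calogero_moser_rhs gamma1 gamma2 x k.
Proof.
move=> /in_chamber_neq0[x0 xB xD].
pose S i := \sum_(j < d | j != i) ((x i - x j)^-1 + (x i + x j)^-1).
have FE i :
  first_order_rhs gamma1 gamma2 x i = gamma1 * S i + gamma2 / x i by [].
pose T j l := (x k - x j) ^- 2 * ((x k - x l)^-1 + (x k + x l)^-1
                - ((x j - x l)^-1 + (x j + x l)^-1))
            + (x k + x j) ^- 2 * ((x k - x l)^-1 + (x k + x l)^-1
                + ((x j - x l)^-1 + (x j + x l)^-1)).
have T0 : \sum_(j < d | j != k) \sum_(l < d | (l != k) && (l != j)) T j l = 0.
  apply: antisymmetric_sum0 => i j ik jk ij; rewrite /T.
  have := xB _ _ ik; have := xB _ _ jk; have := xB _ _ ij.
  rewrite eq_sym in ij; have := xB _ _ ij.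
  move=> h1 h2 h3 h4.
  field; by rewrite !(xD, h1, h2, h3, h4, xB).
have pairE j : j != k ->
    (S k - S j) / (x k - x j) ^+ 2 + (S k + S j) / (x k + x j) ^+ 2 =
    2 * (((x k - x j) ^+ 3)^-1 + ((x k + x j) ^+ 3)^-1)
    + \sum_(l < d | (l != k) && (l != j)) T j l.
  move=> jk; have kj : k != j by rewrite eq_sym.
  pose P := \sum_(l < d | (l != k) && (l != j))
              ((x k - x l)^-1 + (x k + x l)^-1).
  pose Q := \sum_(l < d | (l != k) && (l != j))
              ((x j - x l)^-1 + (x j + x l)^-1).
  have -> : \sum_(l < d | (l != k) && (l != j)) T j l =
      (x k - x j) ^- 2 * (P - Q) + (x k + x j) ^- 2 * (P + Q).
    by rewrite -sumrB -big_split !mulr_sumr -big_split.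
  have -> : S k = (x k - x j)^-1 + (x k + x j)^-1 + P by rewrite /S (bigD1 j).
  have -> : S j = (x j - x k)^-1 + (x j + x k)^-1 + Q.
    rewrite /S (bigD1 k) //; congr (_ + _).
    by apply: eq_bigl => l; rewrite andbC.
  have := xB _ _ jk; have := xB _ _ kj => h1 h2.
  field; by rewrite !(xD, h1, h2).
have sumE : \sum_(j < d | j != k)
    ((S k - S j) / (x k - x j) ^+ 2 + (S k + S j) / (x k + x j) ^+ 2) =
    2 * \sum_(j < d | j != k) (((x k - x j) ^+ 3)^-1 + ((x k + x j) ^+ 3)^-1).
  by rewrite (eq_bigr _ pairE) big_split /= T0 addr0 mulr_sumr.
have crossE : \sum_(j < d | j != k)
    (((x k)^-1 - (x j)^-1) / (x k - x j) ^+ 2 +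
     ((x k)^-1 + (x j)^-1) / (x k + x j) ^+ 2) = - (S k / x k ^+ 2).
  rewrite /S mulr_suml -sumrN; apply: eq_bigr => j jk.
  have := xB _ _ jk => h.
  field; by rewrite !(x0, xD, h).
rewrite /linearized_rhs /calogero_moser_rhs.
have -> : \sum_(j < d | j != k)
    ((first_order_rhs gamma1 gamma2 x k - first_order_rhs gamma1 gamma2 x j)
       / (x k - x j) ^+ 2 +
     (first_order_rhs gamma1 gamma2 x k + first_order_rhs gamma1 gamma2 x j)
       / (x k + x j) ^+ 2) =
  gamma1 * \sum_(j < d | j != k)
    ((S k - S j) / (x k - x j) ^+ 2 + (S k + S j) / (x k + x j) ^+ 2) +
  gamma2 * \sum_(j < d | j != k)
    (((x k)^-1 - (x j)^-1) / (x k - x j) ^+ 2 +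
     ((x k)^-1 + (x j)^-1) / (x k + x j) ^+ 2).
  rewrite !mulr_sumr -big_split; apply: eq_bigr => j jk /=; rewrite !FE.
  ring.
rewrite sumE crossE FE.
set C := \sum_(j < d | _) _.
field; exact: x0.
Qed.

(** A bound for the growth rate of the energy [\sum_k w k ^+ 2] when
    w' = - DF(x) w. It is deliberately crude: all that matters is that it is
    differentiable along the trajectory, hence bounded on compact time
    intervals. *)
Definition energy_rate (gamma1 gamma2 : R) x : R :=
  \sum_(k < d) 2 * (gamma1 * (\sum_(j < d | j != k)
      2 * ((x k - x j) ^- 2 + (x k + x j) ^- 2)) + gamma2 * x k ^- 2).

(** Bounding each product [w k * (w k - w j)] and [w k * (w k + w j)] by twice the
    energy suffices, since their coefficients are nonnegative. This is where the
    signs of [gamma1] and [gamma2] enter. *)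
Lemma energy_rate_bound gamma1 gamma2 x w : 0 <= gamma1 -> 0 <= gamma2 ->
  \sum_(k < d) 2 * (w k * - linearized_rhs gamma1 gamma2 x w k) <=
  energy_rate gamma1 gamma2 x * \sum_(k < d) w k ^+ 2.
Proof.
move=> g1 g2; set E := \sum_(k < d) w k ^+ 2.
have wE k : w k ^+ 2 <= E.
  by rewrite /E (bigD1 k) //= lerDl sumr_ge0 // => j _; exact: sqr_ge0.
have wB k j : w k * (w k - w j) <= 2 * E.
  by have := wE k; have := wE j; have := sqr_ge0 (w k + w j); lra.
have wD k j : w k * (w k + w j) <= 2 * E.
  by have := wE k; have := wE j; have := sqr_ge0 (w k - w j); lra.
rewrite /energy_rate mulr_suml; apply: ler_sum => k _.
rewrite -mulrA ler_pM2l // /linearized_rhs opprK mulrDr mulrDl lerD //.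
  rewrite mulrCA -mulrA ler_wpM2l // mulr_sumr mulr_suml.
  apply: ler_sum => j _.
  have a0 : 0 <= (x k - x j) ^- 2 by rewrite invr_ge0 sqr_ge0.
  have b0 : 0 <= (x k + x j) ^- 2 by rewrite invr_ge0 sqr_ge0.
  have := ler_wpM2r a0 (wB k j); have := ler_wpM2r b0 (wD k j); lra.
rewrite mulrCA -mulrA ler_wpM2l // mulrA -expr2 mulrC.
by rewrite ler_wpM2l // invr_ge0 sqr_ge0.
Qed.

End VectorField.

(** * Evolution along a trajectory in the chamber *)

Section Dynamics.
Context {R : realType} {d : nat}.
Implicit Types (r v : R -> 'I_d -> R).

Lemma has_dot_first_order_rhs (gamma1 gamma2 : R) r (u : 'I_d -> R) (t : R) k :
  0 <= t -> in_chamber (r t) -> (forall j, has_dot (r ^~ j) t (u j)) ->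
  has_dot (fun s => first_order_rhs gamma1 gamma2 (r s) k) t
          (linearized_rhs gamma1 gamma2 (r t) u k).
Proof.
move=> t0 /in_chamber_neq0[x0 xB xD] ru.
have pair j : j != k ->
    has_dot (fun s => (r s k - r s j)^-1 + (r s k + r s j)^-1) t
      (- (u k - u j) / (r t k - r t j) ^+ 2 +
       - (u k + u j) / (r t k + r t j) ^+ 2).
  move=> jk; apply: has_dotD => //.
    by apply: has_dotV => //; [exact: xB | exact: has_dotB].
  by apply: has_dotV => //; exact: has_dotD.
have D := has_dotD t0
  (has_dotZ gamma1 t0 (has_dot_sum (index_enum 'I_d) t0 pair))
  (has_dotZ gamma2 t0 (has_dotV t0 (x0 k) (ru k))).
apply: (eq_ind _ (has_dot _ t) D).
rewrite /linearized_rhs opprD -mulrN -sumrN mulNr mulrN; congr (_ * _ + _).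
by apply: eq_bigr => j _; ring.
Qed.

Lemma has_dot_energy_rate (gamma1 gamma2 : R) r v (t : R) :
  0 <= t -> in_chamber (r t) -> (forall j, has_dot (r ^~ j) t (v t j)) ->
  exists l, has_dot (fun s => energy_rate gamma1 gamma2 (r s)) t l.
Proof.
move=> t0 /in_chamber_neq0[x0 xB xD] rv.
have invsq f l : f t != 0 -> has_dot f t l ->
    has_dot (fun s => f s ^- 2) t (- (f t * l + f t * l) / (f t ^+ 2) ^+ 2).
  move=> ft0 fl; apply: (has_dotV (f := fun s => f s ^+ 2)) => //.
    by rewrite expf_neq0.
  exact: has_dotM.
eexists; apply: has_dot_sum => // k _; apply: has_dotZ => //.
apply: has_dotD => //; apply: has_dotZ => //; last exact: invsq.
apply: has_dot_sum => // j jk; apply: has_dotZ => //; apply: has_dotD => //.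
  by apply: (invsq (fun s => r s k - r s j)); [exact: xB | exact: has_dotB].
by apply: (invsq (fun s => r s k + r s j)); [exact: xD | exact: has_dotD].
Qed.

(** Uniqueness for the linear equation w' = - DF(r) w along a differentiable
    trajectory [r], from Gronwall applied to the energy. *)
Lemma linearized_flow_eq0 (gamma1 gamma2 : R) r v (w : R -> 'I_d -> R) :
  0 <= gamma1 -> 0 <= gamma2 -> (forall t, 0 <= t -> in_chamber (r t)) ->
  (forall t k, 0 <= t -> has_dot (r ^~ k) t (v t k)) ->
  (forall t k, 0 <= t ->
     has_dot (w ^~ k) t (- linearized_rhs gamma1 gamma2 (r t) (w t) k)) ->
  (forall k, w 0 k = 0) -> forall t k, 0 <= t -> w t k = 0.
Proof.
move=> g1 g2 rch rv ww w0 T k T0.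
pose E t := \sum_(j < d) w t j ^+ 2.
have [M EM] := has_dot_bounded T0 (fun s s0 =>
  has_dot_energy_rate gamma1 gamma2 s0 (rch _ s0) (fun j => rv s j s0)).
have Ed s : 0 <= s -> has_dot E s
    (\sum_(j < d) 2 * (w s j * - linearized_rhs gamma1 gamma2 (r s) (w s) j)).
  move=> s0; apply: has_dot_sum => // j _.
  have := has_dotM s0 (ww s j s0) (ww s j s0).
  by rewrite mulr_natl mulr2n.
have E_ge0 s : 0 <= E s by apply: sumr_ge0 => j _; exact: sqr_ge0.
have ET : E T <= 0.
  apply: (gronwall_le0 (C := M) T0 Ed) => [s sT|].
    apply: le_trans (energy_rate_bound _ _ g1 g2) _.
    by apply: ler_wpM2r; [exact: E_ge0 | exact: EM].
  by rewrite /E big1 // => j _; rewrite w0 expr0n.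
apply/eqP; rewrite -sqrf_eq0 eq_le sqr_ge0 andbT (le_trans _ ET) //.
by rewrite /E (bigD1 k) //= lerDl sumr_ge0 // => j _; exact: sqr_ge0.
Qed.

End Dynamics.

Theorem theorem5p1 (R : realType) (d : nat) (hd : (1 <= d)%N)
    (gamma1 gamma2 : R) (hgamma1 : 0 <= gamma1) (hgamma2 : 0 <= gamma2)
    (r : R -> 'I_d -> R)
    (hr : forall t : R, 0 <= t -> in_chamber (r t)) :
  ((forall t : R, 0 <= t -> satisfies_A_at gamma1 gamma2 r t) ->
   forall t : R, 0 <= t -> satisfies_B_at gamma1 gamma2 r t)
  /\
  ((forall t : R, 0 <= t -> satisfies_B_at gamma1 gamma2 r t) ->
   satisfies_A_at gamma1 gamma2 r 0 ->
   forall t : R, 0 <= t -> satisfies_A_at gamma1 gamma2 r t).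
Proof.
split=> [rA t t0 k|rB rA0].
  exists (fun s => first_order_rhs gamma1 gamma2 (r s) k).
  split=> [s s0|]; first exact: rA.
  rewrite -linearized_first_order; last exact: hr.
  by apply: has_dot_first_order_rhs => //; [exact: hr | exact: rA].
have /choice[v' vP] k := rB 0 (lexx 0) k.
pose v t k := v' k t.
have rv t k : 0 <= t -> has_dot (r ^~ k) t (v t k).
  by move=> t0; have [+ _] := vP k; exact.
have vB t k : 0 <= t ->
    has_dot (v ^~ k) t (calogero_moser_rhs gamma1 gamma2 (r t) k).
  move=> t0; have [u [ru ut]] := rB t t0 k.
  (* (B) supplies a velocity for each time t separately; all of these are
     derivatives of the same function, so they agree with [v]. *)
  apply: has_dot_eq ut => // s s0.
  exact: has_dot_unique (ru s s0) (rv s k s0).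
pose w t k := v t k - first_order_rhs gamma1 gamma2 (r t) k.
have wE t k : 0 <= t -> w t k = 0.
  apply: (linearized_flow_eq0 hgamma1 hgamma2 hr rv) => {t k} [t k t0|k].
    rewrite linearized_rhsB linearized_first_order; last exact: hr.
    rewrite opprB; apply: has_dotB => //; first exact: vB.
    by apply: has_dot_first_order_rhs => //; [exact: hr | move=> j; exact: rv].
  apply/eqP; rewrite subr_eq0; apply/eqP.
  exact: has_dot_unique (rv 0 k (lexx 0)) (rA0 k).
move=> t t0 k; have /eqP := wE t k t0; rewrite subr_eq0 => /eqP <-.
exact: rv.
Qed.
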